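(* Let $f,g:\mathbb{R}^n\to\mathbb{R}\cup\{+\infty\}$ be closed convex proper functions and let $h:\mathbb{R}^n\to\mathbb{R}$ be convex and $L$-smooth with $L>0$, such that there exist $x^\star,u^\star\in\mathbb{R}^n$ with $0\in\partial f(x^\star)+\nabla h(x^\star)+u^\star$ and $0\in\partial g^*(u^\star)-x^\star$. Let $\alpha=\frac1L$, let $x^0,u^0\in\mathbb{R}^n$, and let $\{(x^k,u^k)\}_{k\ge 0}$ be generated by $$u^{k+1}=\mathrm{prox}_{\alpha^{-1}g^*}\big(u^k+\tfrac1\alpha x^k\big),\qquad x^{k+1}=\mathrm{prox}_{\alpha f}\Big(x^k-\alpha(2u^{k+1}-u^k)-\alpha\nabla h\big(x^k+\alpha(u^k-u^{k+1})\big)\Big),\qquad k=0,1,2,\dots$$ For each integer $K\ge1$ put $\bar x^K=\frac1K\sum_{k=1}^K x^k$ and $\bar u^K=\frac1K\sum_{k=1}^K u^k$. Then for all integers $K\ge1$, all $x\in\mathrm{dom}\, f$ and all $u\in\mathrm{dom}\, g^*$, $$\mathcal{L}(\bar x^K,u)-\mathcal{L}(x,\bar u^K)\le\frac{1}{\alpha K}\left(\|x^0-x\|^2+\alpha^2\|u^0-u\|^2\right).$$ Moreover, this inequality holds with equality if and only if the six quantities $I_f,I_g,I_h,\mathcal{S}_h,\mathcal{S}_1,\mathcal{S}_2$ defined in the context (for these $K,x,u$, and with the subgradients entering their definition chosen as there) are all zero.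
   Context: $\langle\cdot,\cdot\rangle$ and $\|\cdot\|$ are the standard inner product and Euclidean norm on $\mathbb{R}^n$. $h$ is $L$-smooth if it is differentiable with $L$-Lipschitz gradient. $g^*(y)=\sup_x\{\langle y,x\rangle-g(x)\}$ is the Fenchel conjugate, $\partial$ the convex subdifferential, and $\mathrm{prox}_\varphi(x)=\arg\min_{y}\{\varphi(y)+\frac12\|y-x\|^2\}$. The Lagrangian is $\mathcal{L}(x,u)=f(x)+h(x)+\langle u,x\rangle-g^*(u)$. The iteration is the Davis--Yin splitting algorithm (variant DYS-$gf$) for minimizing $f+g+h$. For $k\ge1$ let $p^k=\alpha u^{k-1}+x^{k-1}-\alpha u^k\in\partial g^*(u^k)$, let $\widetilde\nabla f(x^k)=\frac1\alpha\big(x^{k-1}-\alpha(2u^k-u^{k-1})-\alpha\nabla h(p^k)-x^k\big)\in\partial f(x^k)$ (the subgradient determined by the proximal step), and $v^k=\widetilde\nabla f(x^k)+u^k+\nabla h(p^k)$. Let $\bar p^K\in\partial g^*(\bar u^K)$, $p\in\partial g^*(u)$ and $\widetilde\nabla f(\bar x^K)\in\partial f(\bar x^K)$ be arbitrary subgradients; their existence is presupposed whenever the following quantities are used: $$I_f=\tfrac1K\sum_{k=1}^K\big(f(\bar x^K)-f(x^k)+\langle\widetilde\nabla f(\bar x^K),x^k-\bar x^K\rangle\big)+\tfrac1K\sum_{k=1}^K\big(f(x^k)-f(x)+\langle\widetilde\nabla f(x^k),x-x^k\rangle\big),$$ $$I_g=\tfrac1K\sum_{k=1}^K\big(g(p^k)-g(\bar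 p^K)+\langle u^k,\bar p^K-p^k\rangle\big)+\tfrac1K\sum_{k=1}^K\big(g(p)-g(p^k)+\langle u,p^k-p\rangle\big),$$ $$I_h=\tfrac1K\sum_{k=1}^K\Big(h(\bar x^K)-h(p^k)+\langle\nabla h(\bar x^K),p^k-\bar x^K\rangle+\tfrac\alpha2\|\nabla h(\bar x^K)-\nabla h(p^k)\|^2\Big)+\tfrac1K\sum_{k=1}^K\Big(h(p^k)-h(x)+\langle\nabla h(p^k),x-p^k\rangle+\tfrac\alpha2\|\nabla h(x)-\nabla h(p^k)\|^2\Big),$$ $$\mathcal{S}_h=\tfrac\alpha2\Big\|\nabla h(\bar x^K)+\tfrac1K\sum_{k=1}^K\big(\widetilde\nabla f(x^k)+u^k\big)\Big\|^2+\tfrac\alpha2\Big\|\nabla h(x)-\tfrac1K\sum_{k=1}^K\nabla h(p^k)\Big\|^2,$$ $$\mathcal{S}_1=\tfrac1{\alpha K}\Big(\Big\|x^0-x-\tfrac\alpha2\sum_{k=1}^K v^k\Big\|^2+\alpha^2\Big\|u^0-u-\tfrac12\sum_{k=1}^K v^k\Big\|^2\Big),$$ $$\mathcal{S}_2=\tfrac{\alpha}{2K^2}\sum_{k=1}^K\sum_{l=1}^{k-1}\Big(\|v^k-\nabla h(p^k)-(v^l-\nabla h(p^l))\|^2+\|\nabla h(p^k)-\nabla h(p^l)\|^2\Big).$$ *)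

(* Defs.v *)
From HB Require Import structures.
From mathcomp Require Import all_boot all_order all_algebra.
From mathcomp Require Import all_classical all_reals all_analysis.
Set Implicit Arguments.
Unset Strict Implicit.
Unset Printing Implicit Defensive.
Import Order.TTheory GRing.Theory Num.Theory.
Import numFieldNormedType.Exports.
Local Open Scope classical_set_scope.
Local Open Scope ring_scope.

(* The library norm `|x| on 'rV[R]_n is the sup norm, hence [enorm]; the two
   induce the same topology, so the library's [closed], [differentiable] and
   'D_v can be used unchanged. *)
Definition dot (R : realType) n (x y : 'rV[R]_n) : R :=
  \sum_(i < n) x ord0 i * y ord0 i.

Definition enorm (R : realType) n (x : 'rV[R]_n) : R := Num.sqrt (dot x x).

Definition grad (R : realType) n (h : 'rV[R]_n -> R) (x : 'rV[R]_n) : 'rV[R]_n :=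
  \row_(i < n) 'D_(delta_mx ord0 i) h x.

Definition smooth (R : realType) n (L : R) (h : 'rV[R]_n -> R) : Prop :=
  (forall x, differentiable h x) /\
  (forall x y, enorm (grad h x - grad h y) <= L * enorm (x - y)).

Section ExtendedRealFunctions.
Variables (R : realType) (n : nat).
Implicit Types (phi : 'rV[R]_n -> \bar R) (x y : 'rV[R]_n).
Local Open Scope ereal_scope.

Definition edom phi : set 'rV[R]_n := [set x | phi x < +oo].

Definition epigraph phi : set ('rV[R]_n * R) := [set z | phi z.1 <= z.2%:E].

(* Since 0 * +oo = 0 in \bar R, the endpoints t = 0, 1 impose nothing. *)
Definition econvex phi : Prop :=
  forall x y (t : R), (0 <= t <= 1)%R ->
  phi (t *: x + (1 - t) *: y)%R <= t%:E * phi x + (1 - t)%:E * phi y.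

Definition eproper phi : Prop :=
  (forall x, phi x != -oo) /\ (exists x, edom phi x).

Definition closed_convex_proper phi : Prop :=
  [/\ closed (epigraph phi), econvex phi & eproper phi].

Definition fenchel phi y : \bar R :=
  ereal_sup [set (dot y x)%:E - phi x | x in [set: 'rV[R]_n]].

(* Empty outside the set where phi is finite. *)
Definition subdiff phi x : set 'rV[R]_n :=
  [set s | phi x \is a fin_num /\
           forall y, phi x + (dot s (y - x)%R)%:E <= phi y].

Definition argmin phi : set 'rV[R]_n := [set y | forall z, phi y <= phi z].

Definition prox phi x : set 'rV[R]_n :=
  argmin (fun y => phi y + (2^-1 * enorm (y - x) ^+ 2)%:E).

End ExtendedRealFunctions.

Section DavisYin.
Variables (R : realType) (n : nat).
Variables (f g : 'rV[R]_n -> \bar R) (h : 'rV[R]_n -> R) (alpha : R).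
Implicit Types (x u : nat -> 'rV[R]_n).

(* [fenchel g v] and [f y] are finite wherever this is evaluated, so the
   convention for +oo - +oo is immaterial. *)
Definition lagrangian (y v : 'rV[R]_n) : \bar R :=
  (f y + (h y)%:E + (dot v y)%:E - fenchel g v)%E.

Definition DYS_gf x u : Prop :=
  forall k : nat,
    prox (fun y => ((alpha^-1)%:E * fenchel g y)%E)
         (u k + alpha^-1 *: x k) (u k.+1) /\
    prox (fun y => (alpha%:E * f y)%E)
         (x k - alpha *: (2 *: u k.+1 - u k)
              - alpha *: grad h (x k + alpha *: (u k - u k.+1)))
         (x k.+1).

Definition average (K : nat) (z : nat -> 'rV[R]_n) : 'rV[R]_n :=
  K%:R^-1 *: \sum_(1 <= k < K.+1) z k.

(* [p_], [sf_] and [v_] are meant for k >= 1. *)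
Definition p_ x u (k : nat) : 'rV[R]_n :=
  alpha *: u k.-1 + x k.-1 - alpha *: u k.

Definition sf_ x u (k : nat) : 'rV[R]_n :=
  alpha^-1 *: (x k.-1 - alpha *: (2 *: u k - u k.-1)
               - alpha *: grad h (p_ x u k) - x k).

Definition v_ x u (k : nat) : 'rV[R]_n :=
  sf_ x u k + u k + grad h (p_ x u k).

(* In the quantities below [y], [w] are the comparison points; [sfb], [pb],
   [q] are the chosen subgradients of f at xbar^K, of g^* at ubar^K and
   of g^* at [w]. *)

Definition I_f x u (K : nat) (y sfb : 'rV[R]_n) : \bar R :=
  let xb := average K x in
  ((K%:R^-1)%:E * (\sum_(1 <= k < K.+1)
      (f xb - f (x k) + (dot sfb (x k - xb)%R)%:E))
   + (K%:R^-1)%:E * (\sum_(1 <= k < K.+1)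
      (f (x k) - f y + (dot (sf_ x u k) (y - x k)%R)%:E)))%E.

Definition I_g x u (K : nat) (w pb q : 'rV[R]_n) : \bar R :=
  ((K%:R^-1)%:E * (\sum_(1 <= k < K.+1)
      (g (p_ x u k) - g pb + (dot (u k) (pb - p_ x u k)%R)%:E))
   + (K%:R^-1)%:E * (\sum_(1 <= k < K.+1)
      (g q - g (p_ x u k) + (dot w (p_ x u k - q)%R)%:E)))%E.

Definition I_h x u (K : nat) (y : 'rV[R]_n) : R :=
  let xb := average K x in
  K%:R^-1 * (\sum_(1 <= k < K.+1)
      (h xb - h (p_ x u k) + dot (grad h xb) (p_ x u k - xb)
       + alpha / 2 * enorm (grad h xb - grad h (p_ x u k)) ^+ 2))
  + K%:R^-1 * (\sum_(1 <= k < K.+1)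
      (h (p_ x u k) - h y + dot (grad h (p_ x u k)) (y - p_ x u k)
       + alpha / 2 * enorm (grad h y - grad h (p_ x u k)) ^+ 2)).

Definition S_h x u (K : nat) (y : 'rV[R]_n) : R :=
  alpha / 2 * enorm (grad h (average K x)
    + K%:R^-1 *: \sum_(1 <= k < K.+1) (sf_ x u k + u k)) ^+ 2
  + alpha / 2 * enorm (grad h y
    - K%:R^-1 *: \sum_(1 <= k < K.+1) grad h (p_ x u k)) ^+ 2.

Definition S_1 x u (K : nat) (y w : 'rV[R]_n) : R :=
  (alpha * K%:R)^-1 *
  (enorm (x 0%N - y - (alpha / 2) *: \sum_(1 <= k < K.+1) v_ x u k) ^+ 2
   + alpha ^+ 2 *
     enorm (u 0%N - w - 2^-1 *: \sum_(1 <= k < K.+1) v_ x u k) ^+ 2).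

Definition S_2 x u (K : nat) : R :=
  alpha / (2 * K%:R ^+ 2) *
  \sum_(1 <= k < K.+1) \sum_(1 <= l < k)
    (enorm (v_ x u k - grad h (p_ x u k)
            - (v_ x u l - grad h (p_ x u l))) ^+ 2
     + enorm (grad h (p_ x u k) - grad h (p_ x u l)) ^+ 2).

End DavisYin.

(* Main.v *)
Require Import Defs.
From HB Require Import structures.
From mathcomp Require Import all_boot all_order all_algebra.
From mathcomp Require Import all_classical all_reals all_analysis.
From mathcomp Require Import ring lra.
Import Order.TTheory GRing.Theory Num.Theory.
Import numFieldNormedType.Exports.
Local Open Scope classical_set_scope.
Local Open Scope ring_scope.

(** Write [a k = sf k + u k], [b k = grad h (p k)], so that [v k = a k + b k],
    and let [V], [ubar], [xbar] be the sum of the [v k] and the averages of the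
    [u k] and [x k].  One iteration amounts to [p k = x k + alpha v k] together
    with [z k = z k.-1 - alpha v k] for [z k = x k + alpha u k].  These linear
    relations alone give ([energy_identity]), for any comparison points [y] and
    [w], an exact formula for [<w, xbar> - <ubar, y>]: the upper bound of the
    theorem, minus [S_h + S_1 + S_2], plus the average of the inner products of
    subgradients and gradients with displacements, and of the squared gradient
    differences, that occur in the [I] terms.  Two completions of squares produce
    it.  Telescoping [z] turns the average of [<z k - y - alpha w, v k>] into a
    quadratic in [V], which yields the bound minus [S_1]; the remaining squares are
    [|a k + grad h xbar| ^ 2] and [|b k - grad h y| ^ 2], and splitting their
    averages into squared mean and variance gives [S_h] and [S_2].

    Adding the function values to both sides, these terms combine with them into
    [I_f], [I_g] and [I_h], whence

      gap = bound + I_f + I_g + I_h - S_h - S_1 - S_2.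

    The [S] terms are sums of squares.  The [I] terms are nonpositive: [I_f] and
    the conjugate form of [I_g] by Jensen's inequality and the subgradient
    inequality ([average_subdiff_le0]), and [I_h] by cocoercivity of the gradient
    of a smooth convex function ([smooth_convex_grad_le]), whose constant
    [1 / (2 L)] is half the step.  So the gap is at most the bound, with equality
    exactly when all six terms vanish.

    The optimality conditions of the two proximal steps ([prox_subdiff]) provide
    the subgradients of [f] and of [g^*].  Since [I_g] is expressed with values
    of [g] and not of [g^*], it also takes equality in the Fenchel-Young
    inequality wherever a subgradient of [g^*] occurs ([subdiff_fenchel_eq]);
    that is where closedness of [g] enters. *)

(** * The Euclidean inner product *)

Section InnerProduct.
Context {R : realType} {n : nat}.
Implicit Types (x y z : 'rV[R]_n) (a : R).

Lemma dotC x y : dot x y = dot y x.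
Proof. by apply: eq_bigr => i _; rewrite mulrC. Qed.

Lemma dotDl x y z : dot (x + y) z = dot x z + dot y z.
Proof. by rewrite -big_split; apply: eq_bigr => i _; rewrite mxE mulrDl. Qed.

Lemma dotZl a x y : dot (a *: x) y = a * dot x y.
Proof. by rewrite mulr_sumr; apply: eq_bigr => i _; rewrite mxE mulrA. Qed.

Lemma dotNl x y : dot (- x) y = - dot x y.
Proof. by rewrite -scaleN1r dotZl mulN1r. Qed.

Lemma dot0l y : dot 0 y = 0.
Proof. by rewrite -(scale0r 0) dotZl mul0r. Qed.

Lemma dotDr x y z : dot x (y + z) = dot x y + dot x z.
Proof. by rewrite !(dotC x) dotDl. Qed.

Lemma dotZr a x y : dot x (a *: y) = a * dot x y.
Proof. by rewrite !(dotC x) dotZl. Qed.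

Lemma dotNr x y : dot x (- y) = - dot x y.
Proof. by rewrite !(dotC x) dotNl. Qed.

Definition dotE := (dotDl, dotDr, dotNl, dotNr, dotZl, dotZr).

Lemma dot_sumr x m (F : nat -> 'rV[R]_n) :
  dot x (\sum_(1 <= k < m) F k) = \sum_(1 <= k < m) dot x (F k).
Proof.
apply: (big_morph (dot x)) => [y z|]; first exact: dotDr.
by rewrite dotC dot0l.
Qed.

Lemma dot_suml x m (F : nat -> 'rV[R]_n) :
  dot (\sum_(1 <= k < m) F k) x = \sum_(1 <= k < m) dot (F k) x.
Proof. by rewrite dotC dot_sumr; apply: eq_bigr => k _; exact: dotC. Qed.

Lemma dot_ge0 x : 0 <= dot x x.
Proof. by apply: sumr_ge0 => i _; rewrite -expr2 sqr_ge0. Qed.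

Lemma dot_eq0 x : dot x x = 0 -> x = 0.
Proof.
move=> /eqP; rewrite psumr_eq0 => [|i _]; last by rewrite -expr2 sqr_ge0.
move=> /allP x0; apply/rowP => i; rewrite mxE; apply/eqP.
by have := x0 i; rewrite mem_index_enum -expr2 sqrf_eq0 => /(_ isT).
Qed.

Lemma enorm_sqr x : enorm x ^+ 2 = dot x x.
Proof. by rewrite sqr_sqrtr ?dot_ge0. Qed.

Lemma enorm_ge0 x : 0 <= enorm x.
Proof. exact: sqrtr_ge0. Qed.

Lemma enormN x : enorm (- x) = enorm x.
Proof. by rewrite /enorm dotNl dotNr opprK. Qed.

Lemma dot_le_enorm x y : dot x y <= enorm x * enorm y.
Proof.
set a := enorm x; set b := enorm y.
have a0 : 0 <= a := enorm_ge0 x.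
have b0 : 0 <= b := enorm_ge0 y.
have ha : dot x x = a ^+ 2 by rewrite enorm_sqr.
have hb : dot y y = b ^+ 2 by rewrite enorm_sqr.
have := dot_ge0 (b *: x - a *: y).
rewrite !dotE ha hb (dotC y x) => h.
have {h} : 0 <= a * b * (a * b - dot x y) by nra.
have [ab0 _|ab_neq0] := eqVneq (a * b) 0; last first.
  by rewrite pmulr_rge0 ?subr_ge0// lt0r ab_neq0 mulr_ge0.
have : a = 0 \/ b = 0.
  by move/eqP: ab0; rewrite mulf_eq0 => /orP[] /eqP ->; [left|right].
move=> [h|h].
  by move: ha; rewrite h expr0n => /dot_eq0 ->; rewrite dot0l mul0r.
by move: hb; rewrite h expr0n => /dot_eq0 ->; rewrite dotC dot0l mulr0.
Qed.

(** Turns Euclidean bounds into the coordinatewise boxes from which compact sets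
    of vectors are built. *)
Lemma coord_le_enorm x i : `|x ord0 i| <= enorm x.
Proof.
rewrite -sqrtr_sqr; apply: ler_wsqrtr.
rewrite /dot (bigD1 i) //= -expr2 lerDl.
by apply: sumr_ge0 => j _; rewrite -expr2 sqr_ge0.
Qed.

Lemma continuous_dot {T : topologicalType} {F G : T -> 'rV[R]_n} :
  continuous F -> continuous G -> continuous (fun t => dot (F t) (G t)).
Proof.
move=> cF cG t; rewrite /dot.
have cS := @add_continuous R.
apply: (cvg_big cS) => i _.
apply: (@continuousM _ _ (fun t => F t ord0 i) (fun t => G t ord0 i)).
- have cFi := @coord_continuous R 1 n ord0 i (F t).
  exact: (continuous_comp (cF t) cFi).
- have cGi := @coord_continuous R 1 n ord0 i (G t).
  exact: (continuous_comp (cG t) cGi).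
Qed.

End InnerProduct.

(** * Extended-real convex functions *)

Section ConvexAnalysis.
Context {R : realType} {n : nat}.
Implicit Types (phi g : 'rV[R]_n -> \bar R) (x y z u p : 'rV[R]_n).

Lemma fenchel_young g u z : ((dot u z)%:E - g z <= fenchel g u)%E.
Proof. by apply: ereal_sup_ubound; exists z. Qed.

Lemma fenchel_neqNy g u : eproper g -> fenchel g u != -oo%E.
Proof.
move=> [gNy [z gz]]; rewrite -ltNye; apply: lt_le_trans (fenchel_young g u z).
have /fineK <- : g z \is a fin_num by rewrite fin_numE gNy lt_eqF.
by rewrite -EFinB ltNyr.
Qed.

Lemma fenchel_econvex g : eproper g -> econvex (fenchel g).
Proof.
move=> [gNy _] u v t /andP[t0 t1]; apply: ge_ereal_sup => _ [z _ <-].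
have := gNy z; case gz: (g z) => [r| |] // _; last first.
  by rewrite /= addeNy leNye.
have -> : ((dot (t *: u + (1 - t) *: v) z)%:E - r%:E
   = t%:E * ((dot u z)%:E - r%:E) + (1 - t)%:E * ((dot v z)%:E - r%:E))%E.
  by rewrite -!EFinB -!EFinM -EFinD !dotE; congr (_%:E); ring.
have t10 : 0 <= 1 - t by rewrite subr_ge0.
by apply: leeD; apply: lee_wpmul2l; rewrite ?lee_fin// -gz; exact: fenchel_young.
Qed.

Lemma small_steps_le0 (a b : R) :
  (forall t, 0 < t -> t <= 1 -> a <= t * b) -> a <= 0.
Proof.
move=> ab; have [//|a0] := leP a 0.
have b0 : 0 < a + `|b| by rewrite ltr_wpDr.
have := ab (a / (a + `|b|)) (divr_gt0 a0 b0).
rewrite ler_pdivrMr // mul1r lerDl normr_ge0 => /(_ isT).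
rewrite mulrAC ler_pdivlMr // ler_pM2l //.
by have := ler_norm b; lra.
Qed.

(** The Fermat rule at a proximal point, obtained by moving from [y] towards an
    arbitrary point and letting the step go to zero. *)
Lemma prox_subdiff phi c z y : 0 < c -> econvex phi -> eproper phi ->
  prox (fun v => (c%:E * phi v)%E) z y -> subdiff phi y (c^-1 *: (z - y)).
Proof.
move=> c0 cvx [phiNy [y1 phiy1]] yE.
have phiy : phi y \is a fin_num.
  rewrite fin_numE phiNy; apply/negP => /eqP phiy.
  have := yE y1; rewrite phiy.
  have /fineK <- : phi y1 \is a fin_num by rewrite fin_numE phiNy lt_eqF.
  by rewrite gt0_muley ?lte_fin// addye// leye_eq.
split=> // v; have := phiNy v; case phiv : (phi v) => [b| |] // _; last first.
  by rewrite leey.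
case phiyE : (phi y) phiy => [a| |] // _; rewrite -EFinD lee_fin.
set d := v - y.
have step t : 0 < t -> t <= 1 ->
    c * (a - b) + dot (z - y) d <= t / 2 * dot d d.
  move=> t0 t1.
  have := cvx v y t; rewrite (ltW t0) t1 phiv phiyE -!EFinM -EFinD => /(_ isT).
  have := yE (t *: v + (1 - t) *: y); rewrite phiyE.
  have := phiNy (t *: v + (1 - t) *: y).
  case: (phi _) => [r| |] // _; rewrite -!EFinM -!EFinD !lee_fin.
  have -> : t *: v + (1 - t) *: y - z = t *: d - (z - y).
    by apply/rowP => i; rewrite !mxE; ring.
  have -> : y - z = - (z - y) by rewrite opprB.
  move: (z - y) (d) => s e; rewrite !enorm_sqr !dotE (dotC e s) => h1 h2.
  have h3 : c * r <= c * (t * b + (1 - t) * a) by rewrite ler_pM2l.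
  rewrite -(ler_pM2l t0); nra.
have {step} : c * (a - b) + dot (z - y) d <= 0.
  apply: (small_steps_le0 _ (dot d d / 2)) => t t0 t1.
  by rewrite mulrCA [leRHS]mulrC; apply: step.
rewrite dotZl -/d -(ler_pM2l c0); move: (dot _ d) => e ed.
have -> : c * (a + c^-1 * e) = c * a + e by field; rewrite gt_eqF.
by lra.
Qed.

(** Jensen's inequality with equal weights, by peeling off the last point. *)
Lemma econvex_average phi K (xs : nat -> 'rV[R]_n) (r : nat -> R) :
  econvex phi -> (0 < K)%N -> (forall k, (0 < k)%N -> phi (xs k) = (r k)%:E) ->
  (phi (average K xs) <= (K%:R^-1 * \sum_(1 <= k < K.+1) r k)%:E)%E.
Proof.
move=> cvx; case: K => // K _ phixs; elim: K => [|K IH].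
  by rewrite /average !big_nat1 invr1 scale1r mul1r phixs.
set t := K.+1%:R / K.+2%:R : R.
have K1 : (K.+1%:R : R) != 0 by rewrite pnatr_eq0.
have K2 : (K.+2%:R : R) != 0 by rewrite pnatr_eq0.
have tC : 1 - t = K.+2%:R^-1.
  apply: (mulIf K2); rewrite mulVf // mulrBl mul1r divfK //.
  by rewrite -(natr1 K.+1) addrC addKr.
have t0 : 0 <= t by rewrite divr_ge0 ?ler0n.
have t10 : 0 <= 1 - t by rewrite tC invr_ge0 ler0n.
have -> : average K.+2 xs = t *: average K.+1 xs + (1 - t) *: xs K.+2.
  rewrite tC /average big_nat_recr //= scalerDr scalerA; congr (_ *: _ + _).
  by rewrite /t mulrAC mulfV // mul1r.
apply: le_trans (cvx _ _ t _) _; first by rewrite t0 -subr_ge0.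
rewrite big_nat_recr //= mulrDr [leRHS]EFinD phixs //; apply: leeD; last first.
  by rewrite -EFinM tC.
apply: le_trans (lee_wpmul2l _ IH) _; first by rewrite lee_fin.
by rewrite -EFinM mulrA /t (mulrAC K.+1%:R) mulfV // mul1r.
Qed.
End ConvexAnalysis.

(** * Subgradients of the conjugate *)

Section Biconjugate.
Context {R : realType} {n : nat}.
Implicit Types (g : 'rV[R]_n -> \bar R) (y z u p : 'rV[R]_n).

(** An affine minorant of slope [u] makes the sublevel sets of the proximal
    objective bounded on the closed epigraph of [g], hence compact. *)
Lemma prox_nonempty g z u : closed (epigraph g) -> eproper g ->
  (fenchel g u < +oo)%E -> exists y, prox g z y.
Proof.
move=> gcl gpr gu; have [gNy [z1 gz1]] := gpr.
have gufin : fenchel g u \is a fin_num.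
  by rewrite fin_numE fenchel_neqNy //= lt_eqF.
have [c gc] : exists c, fenchel g u = c%:E.
  by exists (fine (fenchel g u)); rewrite fineK.
have lb (y : 'rV[R]_n) (t : R) : epigraph g (y, t) -> dot u y - c <= t.
  rewrite /epigraph /= => gyt; have := fenchel_young g u y; rewrite gc.
  have := gNy y; move: gyt; case: (g y) => [r| |] // + _.
  by rewrite -EFinB !lee_fin; lra.
have [r1 gr1] : exists r, g z1 = r%:E.
  by exists (fine (g z1)); rewrite fineK // fin_numE gNy lt_eqF.
pose F (e : 'rV[R]_n * R) := e.2 + 2^-1 * dot (e.1 - z) (e.1 - z).
have cF : continuous F.
  move=> e; apply: cvgD; first exact: cvg_snd.
  apply: cvgM; first exact: cvg_cst.
  have c1 : continuous (fun e : 'rV[R]_n * R => e.1 - z).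
    by move=> e'; apply: cvgB; [exact: cvg_fst|exact: cvg_cst].
  exact: (continuous_dot c1 c1 e).
set M := F (z1, r1).
pose A := epigraph g `&` [set e | F e <= M].
have A0 : A !=set0 by exists (z1, r1); split; rewrite /= ?lexx // /epigraph /= gr1.
have Acl : closed A.
  by apply: closedI => //; apply: (@closed_comp _ _ F [set t | t <= M]).
(* [Q] bounds the square of [y - z + u] on [A], by completing the square *)
set Q := 2 * (M + c - dot u z) + dot u u.
have AQ y t : A (y, t) -> enorm (y - z + u) <= Num.sqrt Q.
  move=> [/lb yt]; rewrite /F /= => yM; apply: ler_wsqrtr.
  have -> : Q = 2 * (M + c - dot u z) + dot u u by [].
  move: yt yM; have -> : y = (y - z) + z by rewrite subrK.
  rewrite addrK; move: (y - z) => w; rewrite !dotE (dotC w u); lra.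
pose lo := - (enorm u * Num.sqrt Q) + dot u z - dot u u - c.
pose I i := `[z ord0 i - u ord0 i - Num.sqrt Q,
              z ord0 i - u ord0 i + Num.sqrt Q]%classic.
pose B := [set y : 'rV[R]_n | forall i, I i (y ord0 i)].
have Acpt : compact A.
  apply: (@subclosed_compact _ _ (B `*` `[lo, M])) => //.
    apply: compact_setX; last exact: segment_compact.
    by apply: (@rV_compact _ _ I) => i; exact: segment_compact.
  move=> [y t] Ayt; have yQ := AQ _ _ Ayt; split => /=.
    move=> i /=; have := coord_le_enorm (y - z + u) i; rewrite !mxE.
    rewrite /I /= in_itv /= => h; have {h} := le_trans h yQ.
    by rewrite ler_norml => /andP[h1 h2]; apply/andP; split; lra.
  case: Ayt => /lb yt; rewrite /F /= => yM.
  rewrite in_itv /=; apply/andP; split; last first.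
    by have := dot_ge0 (y - z); lra.
  rewrite /lo; have := dot_le_enorm (- u) (y - z + u).
  have := ler_wpM2l (enorm_ge0 u) yQ.
  by rewrite enormN !dotE; lra.
have [[y0 t0] /[!inE] -[gy0 _] ymin] :=
  compact_EVT_min A0 Acpt (continuous_subspaceT cF).
exists y0 => y; have := gNy y; case gy : (g y) => [r| |] // _; last first.
  by rewrite addye // leey.
have Fle : F (y0, t0) <= F (y, r).
  have Ayr : epigraph g (y, r) by rewrite /epigraph /= gy.
  have [FM|/ltW MF] := leP (F (y, r)) M.
    by apply: ymin; rewrite inE.
  apply: le_trans MF; apply: ymin; rewrite inE.
  by split => //=; rewrite /epigraph /= gr1.
rewrite !enorm_sqr; apply: (@le_trans _ _ (F (y0, t0))%:E).
  by rewrite /F EFinD; apply: leeD.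
by rewrite -EFinD lee_fin.
Qed.

(** The instance [p \in subdiff g^* u -> u \in subdiff g p] of the
    Fenchel-Moreau theorem, in the form of equality in the Fenchel-Young
    inequality.  Let [z] be the proximal point of [g] at [p + u]: the
    subgradient [p + u - z] of [g] at [z] gives an upper bound for [g^*] at
    [p + u - z], which meets the lower bound coming from [p] only if [z = p]. *)
Lemma subdiff_fenchel_eq g u p : closed_convex_proper g ->
  subdiff (fenchel g) u p -> g p = ((dot u p)%:E - fenchel g u)%E.
Proof.
move=> [gcl gcvx gpr] [gufin up].
have [gNy _] := gpr.
have [z zE] : exists z, prox g (p + u) z.
  by apply: (prox_nonempty g (p + u) u gcl gpr); rewrite ltey_eq gufin.
have [|gz] := prox_subdiff g 1 (p + u) z ltr01 gcvx gpr.
  by move=> v; rewrite !mul1e; exact: zE.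
rewrite invr1 scale1r => sz.
case gzE : (g z) gz sz => [r| |] // _ sz.
case gcE : (fenchel g u) gufin up => [c| |] // _ up.
have gs : (fenchel g (p + u - z)%R <= (dot (p + u - z) z - r)%:E)%E.
  apply: ge_ereal_sup => _ [v _ <-]; have := sz v; have := gNy v.
  case: (g v) => [b| |] // _; last by rewrite addeNy leNye.
  rewrite -EFinB -EFinD !lee_fin !dotE; lra.
have := fenchel_young g u z; rewrite gcE gzE -EFinB lee_fin => guz.
have := le_trans (up _) gs; rewrite -EFinD lee_fin => pz.
have zp : p - z = 0.
  apply: dot_eq0; apply/eqP; rewrite eq_le dot_ge0 andbT.
  by move: pz guz; rewrite !dotE (dotC z p); lra.
have {zp}zp : z = p by apply/esym/eqP; rewrite -subr_eq0 zp.
rewrite -zp gzE -EFinB; congr (_%:E); move: pz guz; rewrite zp !dotE; lra.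
Qed.

End Biconjugate.

(** * Smooth convex functions *)

Section SmoothConvex.
Context {R : realType} {n : nat}.
Implicit Types (h : 'rV[R]_n -> R) (x y v : 'rV[R]_n) (L : R).

Lemma derive_grad h x v : differentiable h x -> 'D_v h x = dot (grad h x) v.
Proof.
move=> dh; rewrite deriveE // [in LHS](row_sum_delta v) linear_sum /dot.
by apply: eq_bigr => i _; rewrite linearZ /= mxE deriveE // mulrC.
Qed.

(** Along a line through [x] the difference quotients at [t] are literally those of
    [h] at [t v + x] in the direction [v]. *)
Lemma is_derive_line h x v (t : R) : (forall y, differentiable h y) ->
  is_derive t 1 (fun s => h (s *: v + x)) (dot (grad h (t *: v + x)) v).
Proof.
move=> dh; rewrite -derive_grad //.
have lineE : (fun s : R => s^-1 *: (h ((s *: 1 + t) *: v + x) - h (t *: v + x)))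
    = (fun s => s^-1 *: (h (s *: v + (t *: v + x)) - h (t *: v + x))).
  by apply/funext => s; rewrite [s *: 1]mulr1 scalerDl addrA.
apply: DeriveDef.
  have := @diff_derivable _ _ _ _ _ v (dh (t *: v + x)).
  by rewrite /derivable /= -lineE.
by rewrite /derive /= -lineE.
Qed.

(** The function [s |-> h (s v + x) - s <grad h x, v> - (L / 2) s ^ 2 |v| ^ 2]
    is nonincreasing on [0, 1]: by Cauchy-Schwarz its derivative is at most
    [|grad h (s v + x) - grad h x| |v| - L s |v| ^ 2]. *)
Lemma smooth_descent L h x y : smooth L h ->
  h y <= h x + dot (grad h x) (y - x) + L / 2 * dot (y - x) (y - x).
Proof.
move=> [dh hL]; set v : 'rV[R]_n := y - x.
have yE : y = 1 *: v + x by rewrite scale1r subrK.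
pose a := dot (grad h x) v; pose b := L / 2 * dot v v.
pose psi s := h (s *: v + x) - s * a - s ^+ 2 * b.
pose dpsi s := dot (grad h (s *: v + x)) v - a - 2 * s * b.
have dpsiE (s : R) : is_derive s 1 psi (dpsi s).
  have dline := is_derive_line h x v s dh.
  have -> : psi = (fun s => h (s *: v + x)) - (a *: id + b *: (id ^+ 2)).
    by apply/funext => r; rewrite /psi !fctE /GRing.scale /=; ring.
  apply: is_derive_eq.
  rewrite /dpsi /GRing.scale /=; ring.
have [|c] := @MVT_segment R psi dpsi 0 1 ler01 (fun s _ => dpsiE s) _.
  apply: derivable_within_continuous => s _.
  by case: (dpsiE s).
rewrite in_itv /= => /andP[c0 c1].
have dpsi_le0 : dpsi c <= 0.
  have := dot_le_enorm (grad h (c *: v + x) - grad h x) v.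
  have := ler_wpM2r (enorm_ge0 v) (hL (c *: v + x) x).
  rewrite addrK dotDl dotNl -/a.
  have -> : enorm (c *: v) = c * enorm v.
    rewrite /enorm dotZl dotZr mulrA -expr2 sqrtrM ?sqr_ge0 //.
    by rewrite sqrtr_sqr ger0_norm.
  have : enorm v * enorm v = dot v v by rewrite -expr2 enorm_sqr.
  rewrite /dpsi /b; set e := enorm v => ee.
  have -> : 2 * c * (L / 2 * dot v v) = L * (c * e) * e.
    by rewrite -ee; field.
  by lra.
rewrite /psi -yE scale0r add0r subr0 mulr1 => psiE.
have : h y - a - b - h x <= 0.
  by move: dpsi_le0; rewrite -psiE; lra.
by rewrite /a /b; lra.
Qed.

Lemma gradN h x : differentiable h x -> grad (- h) x = - grad h x.
Proof.
by move=> dh; apply/rowP => i; rewrite !mxE deriveN //; exact: diff_derivable.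
Qed.

Lemma smoothN L h : smooth L h -> smooth L (- h).
Proof.
move=> [dh hL]; split=> [x|x y]; first exact: differentiableN.
by rewrite !gradN // -opprD enormN; exact: hL.
Qed.

(** The tangent inequality, read off from the quadratic lower bound (the descent
    inequality for [- h]) on a short step from [x] towards [y]. *)
Lemma convex_grad_le L h x y :
  convex_function [set: 'rV[R]_n] h -> smooth L h ->
  h x + dot (grad h x) (y - x) <= h y.
Proof.
move=> hcvx hL; have [dh _] := hL.
set v : 'rV[R]_n := y - x.
suff : h x + dot (grad h x) v - h y <= 0 by lra.
apply: (small_steps_le0 _ (L / 2 * dot v v)) => t t0 t1.
have := hcvx (Itv01 (ltW t0) t1) y x; rewrite !inE => /(_ I I).
rewrite convRE /= /unstable.onem.
have -> : conv (Itv01 (ltW t0) t1) (y : convex_lmodType _) x = x + t *: v.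
  by apply/rowP => i; rewrite /conv /= !mxE /unstable.onem; ring.
have := smooth_descent L (- h) x (x + t *: v) (smoothN _ _ hL).
have -> : x + t *: v - x = t *: v by rewrite addrC addKr.
rewrite gradN // !dotE !fctE => h1 h2.
by rewrite -(ler_pM2l t0); lra.
Qed.

(** Cocoercivity of the gradient: compare the tangent at [x] and the quadratic
    upper bound at [y] in the point reached from [y] by a gradient step for
    [h - <grad h x, _>], which is minimal at [x]. *)
Lemma smooth_convex_grad_le L h x y : 0 < L ->
  convex_function [set: 'rV[R]_n] h -> smooth L h ->
  h x + dot (grad h x) (y - x)
    + L^-1 / 2 * dot (grad h x - grad h y) (grad h x - grad h y) <= h y.
Proof.
move=> L0 hcvx hL; set d := grad h x - grad h y.
have := convex_grad_le L h x (y + L^-1 *: d) hcvx hL.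
have := smooth_descent L h y (y + L^-1 *: d) hL.
have -> : y + L^-1 *: d - y = L^-1 *: d by rewrite addrC addKr.
have -> : y + L^-1 *: d - x = (y - x) + L^-1 *: d by rewrite addrAC.
have -> : L / 2 * dot (L^-1 *: d) (L^-1 *: d) = L^-1 / 2 * dot d d.
  by rewrite dotZl dotZr; field; rewrite gt_eqF.
rewrite dotDr !dotZr.
have -> : dot (grad h x) d = dot (grad h y) d + dot d d.
  by rewrite -dotDl; congr (dot _ _); rewrite addrC subrK.
rewrite mulrDr; lra.
Qed.
End SmoothConvex.

(** * The energy identity *)

Section Identity.
Context {R : realType} {n : nat}.
Implicit Types (a b v x y z u w : 'rV[R]_n) (xs us : nat -> 'rV[R]_n).

Lemma sum_constr K (r : R) : \sum_(1 <= k < K.+1) r = K%:R * r.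
Proof. by rewrite sumr_const_nat subSS subn0 mulr_natl. Qed.

Lemma sum_average K xs : (0 < K)%N ->
  \sum_(1 <= k < K.+1) xs k = K%:R *: average K xs.
Proof.
by move=> K0; rewrite scalerA mulfV ?scale1r // pnatr_eq0 -lt0n.
Qed.

Lemma sum_dot_average K s xs : (0 < K)%N ->
  \sum_(1 <= k < K.+1) dot s (xs k - average K xs) = 0.
Proof.
move=> K0; rewrite -dot_sumr sumrB sum_average // sumr_const_nat subSS subn0.
by rewrite scaler_nat subrr dotC dot0l.
Qed.

(** Lagrange's identity for the variance.  Appending a point [c] to [c 1, ..., c K]
    increases both sides by the sum of the [|c - c l| ^ 2] plus
    [2 <c, c 1 + ... + c K> + |c| ^ 2]. *)
Lemma sum_sqr_dist K (c : nat -> 'rV[R]_n) :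
  K%:R * \sum_(1 <= k < K.+1) enorm (c k) ^+ 2 =
  enorm (\sum_(1 <= k < K.+1) c k) ^+ 2 +
  \sum_(1 <= k < K.+1) \sum_(1 <= l < k) enorm (c k - c l) ^+ 2.
Proof.
elim: K => [|K IH]; first by rewrite !big_geq // enorm_sqr dot0l mul0r addr0.
rewrite !(@big_nat_recr _ _ _ K.+1) //=.
have -> : \sum_(1 <= l < K.+1) enorm (c K.+1 - c l) ^+ 2 =
    K%:R * enorm (c K.+1) ^+ 2 - 2 * dot (c K.+1) (\sum_(1 <= l < K.+1) c l)
    + \sum_(1 <= l < K.+1) enorm (c l) ^+ 2.
  have -> : K%:R * enorm (c K.+1) ^+ 2 = \sum_(1 <= l < K.+1) enorm (c K.+1) ^+ 2.
    by rewrite sum_constr.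
  rewrite dot_sumr mulr_sumr -sumrB -big_split /=.
  apply: eq_bigr => l _; rewrite !enorm_sqr !dotE (dotC (c l)); ring.
rewrite -natr1 mulrDl mulrDr IH !enorm_sqr !dotE.
move: (\sum_(1 <= k < K.+1) c k) => C; rewrite (dotC C); ring.
Qed.

(** Squared mean plus variance; the pairwise distances do not see the shift. *)
Lemma sum_sqr_shift K (c : nat -> 'rV[R]_n) s : (0 < K)%N ->
  \sum_(1 <= k < K.+1) enorm (c k + s) ^+ 2 =
  K%:R * enorm (s + K%:R^-1 *: \sum_(1 <= k < K.+1) c k) ^+ 2 +
  K%:R^-1 * \sum_(1 <= k < K.+1) \sum_(1 <= l < k) enorm (c k - c l) ^+ 2.
Proof.
move=> K0; have KR0 : K%:R != 0 :> R by rewrite pnatr_eq0 -lt0n.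
apply: (mulfI KR0); rewrite sum_sqr_dist mulrDr mulVKf //; congr (_ + _).
  have -> : \sum_(1 <= k < K.+1) (c k + s) =
      K%:R *: (s + K%:R^-1 *: \sum_(1 <= k < K.+1) c k).
    rewrite big_split /= sumr_const_nat subSS subn0 addrC.
    by rewrite scalerDr scalerA mulfV // scale1r scaler_nat.
  by rewrite !enorm_sqr dotZl dotZr.
apply: eq_bigr => k _; apply: eq_bigr => l _.
by rewrite opprD addrACA subrr addr0.
Qed.

(** Expand [z 0 = z k + al * (v 1 + ... + v k)] in [<z 0, v k>] and sum: the
    products [<v l, v k>] with [l <= k] are half of [|v 1 + ... + v K| ^ 2] and
    half of the diagonal. *)
Lemma sum_dot_telescope K (al : R) (z v : nat -> 'rV[R]_n) :
  (forall k, z k = z k.+1 + al *: v k.+1) ->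
  \sum_(1 <= k < K.+1) (dot (z k) (v k) + al / 2 * dot (v k) (v k)) =
  dot (z 0%N) (\sum_(1 <= k < K.+1) v k) - al / 2 *
    dot (\sum_(1 <= k < K.+1) v k) (\sum_(1 <= k < K.+1) v k).
Proof.
move=> zS.
have z0 m : z 0%N = z m + al *: \sum_(1 <= k < m.+1) v k.
  elim: m => [|m IH]; first by rewrite big_geq // scaler0 addr0.
  by rewrite IH zS (@big_nat_recr _ _ _ m.+1) //= scalerDr addrA addrAC.
elim: K => [|K IH]; first by rewrite !big_geq // dotC !dot0l mulr0 subr0.
rewrite !(@big_nat_recr _ _ _ K.+1) //= IH; move: (z0 K.+1).
rewrite big_nat_recr //=; move: (\sum_(1 <= k < K.+1) v k) => V ->.
by rewrite !dotE (dotC (v K.+1) V); field.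
Qed.

(** Substituting [p k = x k + al v k], each summand on the right becomes, up to
    terms that are affine in [x k] and [u k], minus the summand of
    [sum_dot_telescope] for [z k = x k + al u k - (y + al w)] plus the squares
    [al / 2 |a k + c| ^ 2] and [al / 2 |grad h y - b k| ^ 2], where
    [a k = v k - b k].  The average of the telescoped part is the leading term
    minus [S_1], and [sum_sqr_shift] splits the squares into [S_h] and [S_2]. *)
Lemma energy_identity (h : 'rV[R]_n -> R) (al : R) xs us K y w :
  al != 0 -> (0 < K)%N ->
  let b k := grad h (p_ al xs us k) in
  let c := grad h (average K xs) in
  dot w (average K xs) - dot (average K us) y =
  (al * K%:R)^-1 * (enorm (xs 0%N - y) ^+ 2 + al ^+ 2 * enorm (us 0%N - w) ^+ 2)
  + K%:R^-1 * (\sum_(1 <= k < K.+1)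
      (dot (sf_ h al xs us k) (y - xs k) + dot (p_ al xs us k) (w - us k)
       + dot c (p_ al xs us k - average K xs) + dot (b k) (y - p_ al xs us k)
       + al / 2 * enorm (c - b k) ^+ 2 + al / 2 * enorm (grad h y - b k) ^+ 2))
  - (S_h h al xs us K y + S_1 h al xs us K y w + S_2 h al xs us K).
Proof.
move=> al0 K0 b c; set d := grad h y; set xb := average K xs.
have KR0 : K%:R != 0 :> R by rewrite pnatr_eq0 -lt0n.
pose p := p_ al xs us; pose sf := sf_ h al xs us.
pose a k := sf k + us k; pose v := v_ h al xs us.
pose z k := xs k + al *: us k - (y + al *: w).
have vE k : v k = a k + b k by [].
have alsf k : al *: sf k = xs k.-1 - al *: (2 *: us k - us k.-1) - al *: b k - xs k.
  by rewrite scalerA mulfV // scale1r.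
have zS k : z k = z k.+1 + al *: v k.+1.
  rewrite vE /a !scalerDr alsf /z /=.
  by apply/rowP => i; rewrite !mxE; ring.
have pE k : (0 < k)%N -> p k = xs k + al *: v k.
  case: k => // k _; rewrite vE /a !scalerDr alsf /p /p_ /=.
  by apply/rowP => i; rewrite !mxE; ring.
pose T k := dot (sf k) (y - xs k) + dot (p k) (w - us k) + dot c (p k - xb)
  + dot (b k) (y - p k) + al / 2 * enorm (c - b k) ^+ 2
  + al / 2 * enorm (d - b k) ^+ 2.
have TE k : (1 <= k < K.+1)%N -> T k = dot w (xs k) - dot (us k) y
    - (dot (z k) (v k) + al / 2 * dot (v k) (v k)) + dot c (xs k - xb)
    + al / 2 * enorm (a k + c) ^+ 2 + al / 2 * enorm (d - b k) ^+ 2.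
  move=> /andP[k0 _]; rewrite /T /= -/(p k) pE //.
  have -> : sf k = a k - us k by rewrite addrK.
  rewrite vE /z !enorm_sqr.
  move: (xs k) (us k) (a k) (b k) (c) (d) => x u r t e q.
  rewrite !dotE (dotC u x) (dotC w x) (dotC r x) (dotC t x) (dotC y r).
  rewrite (dotC y t) (dotC r u) (dotC t u) (dotC w r) (dotC w t) (dotC e r).
  by rewrite (dotC e t) (dotC t q) (dotC t r); field.
set V := \sum_(1 <= k < K.+1) v k.
set SA := \sum_(1 <= k < K.+1) enorm (a k + c) ^+ 2.
set SB := \sum_(1 <= k < K.+1) enorm (d - b k) ^+ 2.
have -> : \sum_(1 <= k < K.+1) T k =
    K%:R * (dot w xb - dot (average K us) y)
    - (dot (z 0%N) V - al / 2 * dot V V) + al / 2 * SA + al / 2 * SB.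
  rewrite (eq_big_nat _ _ TE) !big_split /= !sumrN -dot_sumr -dot_suml.
  rewrite sum_dot_telescope // sum_dot_average // addr0 -!mulr_sumr.
  by rewrite -/V !sum_average // dotZr dotZl mulrBr.
pose A2 := enorm (c + K%:R^-1 *: \sum_(1 <= k < K.+1) a k) ^+ 2.
pose B2 := enorm (d - K%:R^-1 *: \sum_(1 <= k < K.+1) b k) ^+ 2.
pose PA := \sum_(1 <= k < K.+1) \sum_(1 <= l < k) enorm (a k - a l) ^+ 2.
pose PB := \sum_(1 <= k < K.+1) \sum_(1 <= l < k) enorm (b k - b l) ^+ 2.
have SAE : SA = K%:R * A2 + K%:R^-1 * PA.
  exact: sum_sqr_shift.
have SBE : SB = K%:R * B2 + K%:R^-1 * PB.
  have -> : SB = \sum_(1 <= k < K.+1) enorm (b k - d) ^+ 2.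
    by apply: eq_bigr => k _; rewrite -enormN opprB.
  by rewrite sum_sqr_shift // /B2 -(enormN (d - _)) opprB (addrC (- d)).
have -> : S_2 h al xs us K = al / (2 * K%:R ^+ 2) * (PA + PB).
  rewrite /S_2 -big_split /=; congr (_ * _); apply: eq_bigr => k _.
  rewrite -big_split /=; apply: eq_bigr => l _.
  by rewrite -/(v k) -/(v l) !vE !addrK.
rewrite SAE SBE /S_h -/xb -/c -/d -/A2 -/B2 /S_1 -/V !enorm_sqr /z.
move: (xs 0%N) (us 0%N) (V) => x0 u0 V'.
rewrite !dotE (dotC V' x0) (dotC V' y) (dotC V' u0) (dotC V' w).
by rewrite (dotC y x0) (dotC w u0); field; rewrite al0 KR0.
Qed.
End Identity.

(** * Bounds on the remainder terms *)

Section Remainders.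
Context {R : realType} {n : nat}.
Context (f g : 'rV[R]_n -> \bar R) (h : 'rV[R]_n -> R) (al : R).
Context (xs us : nat -> 'rV[R]_n) (K : nat) (K_gt0 : (0 < K)%N).
Implicit Types (y w s p q : 'rV[R]_n).

Lemma DYS_subdiff_conj k : 0 < al -> eproper g -> eproper (fenchel g) ->
  DYS_gf f g h al xs us -> (0 < k)%N ->
  subdiff (fenchel g) (us k) (p_ al xs us k).
Proof.
move=> al0 gpr gspr dys; case: k => // k _; have [uE _] := dys k.
have alV : 0 < al^-1 by rewrite invr_gt0.
have := prox_subdiff _ _ _ _ alV (fenchel_econvex _ gpr) gspr uE.
rewrite invrK scalerBr scalerDr scalerA mulfV ?gt_eqF // scale1r.
exact.
Qed.

Lemma DYS_subdiff k : 0 < al -> econvex f -> eproper f ->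
  DYS_gf f g h al xs us -> (0 < k)%N ->
  subdiff f (xs k) (sf_ h al xs us k).
Proof.
move=> al0 fcvx fpr dys; case: k => // k _; have [_ xE] := dys k.
have := prox_subdiff _ _ _ _ al0 fcvx fpr xE.
rewrite /sf_ /=.
have -> : p_ al xs us k.+1 = xs k + al *: (us k - us k.+1).
  by rewrite /p_ /= scalerBr addrA (addrC (xs k)).
exact.
Qed.

(** Both halves of [I_f], and of [I_g] through [g^*], come down to this: Jensen's
    inequality at the average and the subgradient inequality at each point. *)
Lemma average_subdiff_le0 (phi : 'rV[R]_n -> \bar R) (zs ss : nat -> 'rV[R]_n) y :
  econvex phi -> (forall z, phi z != -oo%E) -> phi y \is a fin_num ->
  (forall k, (0 < k)%N -> subdiff phi (zs k) (ss k)) ->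
  phi (average K zs) \is a fin_num /\
  fine (phi (average K zs)) - fine (phi y)
    + K%:R^-1 * \sum_(1 <= k < K.+1) dot (ss k) (y - zs k) <= 0.
Proof.
move=> cvx phiNy phiy sub.
have KR0 : K%:R != 0 :> R by rewrite pnatr_eq0 -lt0n.
have phiz k : (0 < k)%N -> phi (zs k) = (fine (phi (zs k)))%:E.
  by move=> k0; rewrite fineK //; case: (sub k k0).
have avg := econvex_average _ _ _ _ cvx K_gt0 phiz.
have phia : phi (average K zs) \is a fin_num.
  by rewrite fin_numE phiNy lt_eqF //; apply: le_lt_trans avg (ltry _).
split=> //; move: avg; rewrite -(fineK phia) lee_fin /= => avg.
suff : K%:R^-1 * \sum_(1 <= k < K.+1) fine (phi (zs k)) +
   K%:R^-1 * \sum_(1 <= k < K.+1) dot (ss k) (y - zs k) <= fine (phi y) by lra.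
have -> : fine (phi y) = K%:R^-1 * \sum_(1 <= k < K.+1) fine (phi y).
  by rewrite sum_constr mulKf.
rewrite -mulrDr -big_split /=; apply: ler_wpM2l; first by rewrite invr_ge0.
rewrite !big_nat; apply: ler_sum => k /andP[k0 _].
have [phik sk] := sub k k0.
by have := sk y; rewrite -(fineK phik) -(fineK phiy) -EFinD lee_fin.
Qed.

(** The displacements [xs k - xbar] sum to zero, which eliminates the subgradient at
    the average, and the values [f (xs k)] cancel between the two halves. *)
Lemma I_fE y s : f (average K xs) \is a fin_num -> f y \is a fin_num ->
  (forall k, (0 < k)%N -> f (xs k) \is a fin_num) ->
  I_f f h al xs us K y s =
  (fine (f (average K xs)) - fine (f y)
   + K%:R^-1 * \sum_(1 <= k < K.+1) dot (sf_ h al xs us k) (y - xs k))%:E.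
Proof.
move=> fa fy fx; rewrite /I_f.
have KR0 : K%:R != 0 :> R by rewrite pnatr_eq0 -lt0n.
have fxE k : (1 <= k < K.+1)%N -> f (xs k) = (fine (f (xs k)))%:E.
  by move=> /andP[k0 _]; rewrite fineK // fx.
rewrite -(fineK fa) -(fineK fy).
under eq_big_nat => k kK do rewrite fxE // -EFinB -EFinD.
under [X in (_ + _ * X)%E]eq_big_nat => k kK do rewrite fxE // -EFinB -EFinD.
rewrite !sumEFin -!EFinM -EFinD; congr (_%:E).
rewrite !big_split /= sum_dot_average // !sumrN !sum_constr.
by field.
Qed.

(** Equality in the Fenchel-Young inequality at [(us k, p k)], [(ubar, p)] and
    [(w, q)] replaces the values of [g] by values of [g^*], and so gives [I_g] the
    form that [I_f] has, with [g^*], [us k] and [p k] for [f], [xs k] and [sf k]. *)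
Lemma I_gE w p q : closed_convex_proper g ->
  subdiff (fenchel g) (average K us) p -> subdiff (fenchel g) w q ->
  (forall k, (0 < k)%N -> subdiff (fenchel g) (us k) (p_ al xs us k)) ->
  I_g g al xs us K w p q =
  (fine (fenchel g (average K us)) - fine (fenchel g w)
   + K%:R^-1 * \sum_(1 <= k < K.+1) dot (p_ al xs us k) (w - us k))%:E.
Proof.
move=> gccp ap wq up; rewrite /I_g.
have KR0 : K%:R != 0 :> R by rewrite pnatr_eq0 -lt0n.
have gE v z : subdiff (fenchel g) v z -> g z = (dot v z - fine (fenchel g v))%:E.
  by move=> vz; rewrite (subdiff_fenchel_eq _ _ _ gccp vz) EFinB fineK //; case: vz.
have gpE k : (1 <= k < K.+1)%N -> g (p_ al xs us k) =
    (dot (us k) (p_ al xs us k) - fine (fenchel g (us k)))%:E.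
  by move=> /andP[k0 _]; apply: gE; exact: up.
rewrite (gE _ _ ap) (gE _ _ wq).
under eq_big_nat => k kK do rewrite gpE // -EFinB -EFinD.
under [X in (_ + _ * X)%E]eq_big_nat => k kK do rewrite gpE // -EFinB -EFinD.
rewrite !sumEFin -!EFinM -EFinD; congr (_%:E).
set P := p_ al xs us; set a := fine (fenchel g (average K us)).
set b := fine (fenchel g w).
rewrite -mulrDr -big_split /=.
transitivity (K%:R^-1 * \sum_(1 <= k < K.+1)
    (dot p (us k - average K us) + (a - b) + dot (P k) (w - us k))).
  congr (_ * _); apply: eq_bigr => k _.
  move: (P k) (us k) (average K us) => r t e; rewrite !dotE.
  rewrite (dotC p t) (dotC p e) (dotC r t) (dotC r w); ring.
rewrite !big_split /= sum_dot_average // !sum_constr.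
by field.
Qed.

Lemma I_hE y : let b k := grad h (p_ al xs us k) in
  I_h h al xs us K y = h (average K xs) - h y + K%:R^-1 * \sum_(1 <= k < K.+1)
    (dot (grad h (average K xs)) (p_ al xs us k - average K xs)
     + dot (b k) (y - p_ al xs us k)
     + al / 2 * enorm (grad h (average K xs) - b k) ^+ 2
     + al / 2 * enorm (grad h y - b k) ^+ 2).
Proof.
move=> b; have KR0 : K%:R != 0 :> R by rewrite pnatr_eq0 -lt0n.
rewrite /I_h -mulrDr -big_split /=.
have -> : h (average K xs) - h y = K%:R^-1 *
    \sum_(1 <= k < K.+1) (h (average K xs) - h y).
  by rewrite sum_constr mulKf.
rewrite -mulrDr -big_split /=; congr (_ * _); apply: eq_bigr => k _.
by rewrite -/(b k); ring.
Qed.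

(** Each half is the cocoercivity inequality, from the average to [p k] and from
    [p k] to [y]; the step length [1 / L] is what matches its constant. *)
Lemma I_h_le0 L y : 0 < L -> al = 1 / L ->
  convex_function [set: 'rV[R]_n] h -> smooth L h -> I_h h al xs us K y <= 0.
Proof.
move=> L0 alE hcvx hL; have alLV : al = L^-1 by rewrite alE div1r.
have KV : 0 <= K%:R^-1 :> R by rewrite invr_ge0.
rewrite /I_h alLV -oppr_ge0 opprD -!mulrN -!sumrN.
apply: addr_ge0; apply: mulr_ge0 => //; apply: sumr_ge0 => k _; rewrite oppr_ge0.
- have := smooth_convex_grad_le _ _ (average K xs) (p_ L^-1 xs us k) L0 hcvx hL.
  by rewrite enorm_sqr; lra.
- have := smooth_convex_grad_le _ _ (p_ L^-1 xs us k) y L0 hcvx hL.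
  by rewrite -enormN (opprB (grad h y)) enorm_sqr; lra.
Qed.

Lemma S_h_ge0 y : 0 < al -> 0 <= S_h h al xs us K y.
Proof.
by move=> al0; rewrite addr_ge0 // mulr_ge0 ?sqr_ge0 // divr_ge0 // ltW.
Qed.

Lemma S_1_ge0 y w : 0 < al -> 0 <= S_1 h al xs us K y w.
Proof.
move=> al0; apply: mulr_ge0; first by rewrite invr_ge0 mulr_ge0 // ltW.
by rewrite addr_ge0 ?sqr_ge0 // mulr_ge0 ?sqr_ge0.
Qed.

Lemma S_2_ge0 : 0 < al -> 0 <= S_2 h al xs us K.
Proof.
move=> al0; apply: mulr_ge0.
  by rewrite divr_ge0 ?mulr_ge0 ?sqr_ge0 // ltW.
by do 2![apply: sumr_ge0 => ? _]; rewrite addr_ge0 ?sqr_ge0.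
Qed.

End Remainders.

(** * The Lagrangian gap *)

Theorem theorem4p2 (R : realType) (n : nat)
    (f g : 'rV[R]_n -> \bar R) (h : 'rV[R]_n -> R) (L alpha : R)
    (x u : nat -> 'rV[R]_n)
    (f_ccp : closed_convex_proper f)
    (g_ccp : closed_convex_proper g)
    (h_convex : convex_function [set: 'rV[R]_n] h)
    (L_gt0 : 0 < L)
    (h_smooth : smooth L h)
    (saddle : exists xs us : 'rV[R]_n,
       [set s + grad h xs + us | s in subdiff f xs] 0 /\
       [set s - xs | s in subdiff (fenchel g) us] 0)
    (alphaE : alpha = 1 / L)
    (xu_DYS : DYS_gf f g h alpha x u) :
  forall (K : nat) (y w : 'rV[R]_n),
    (1 <= K)%N -> edom f y -> edom (fenchel g) w ->
    let gap := (lagrangian f g h (average K x) w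
                - lagrangian f g h y (average K u))%E in
    let bound := 1 / (alpha * K%:R) *
      (enorm (x 0%N - y) ^+ 2 + alpha ^+ 2 * enorm (u 0%N - w) ^+ 2) in
    (gap <= bound%:E)%E /\
    (forall sfb pb q : 'rV[R]_n,
       subdiff f (average K x) sfb ->
       subdiff (fenchel g) (average K u) pb ->
       subdiff (fenchel g) w q ->
       gap = bound%:E <->
       (I_f f h alpha x u K y sfb = 0%E /\
        I_g g alpha x u K w pb q = 0%E /\
        I_h h alpha x u K y = 0 /\
        S_h h alpha x u K y = 0 /\
        S_1 h alpha x u K y w = 0 /\
        S_2 h alpha x u K = 0)).
Proof.
move=> K y w K_gt0 fy gw gap bound.
have alpha_gt0 : 0 < alpha by rewrite alphaE div1r invr_gt0.
have [_ f_convex f_proper] := f_ccp; have [fNy _] := f_proper.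
have [_ _ g_proper] := g_ccp.
have gsNy v : fenchel g v != -oo%E := fenchel_neqNy _ v g_proper.
have gs_proper : eproper (fenchel g) by split; last by exists w.
have fy_fin : f y \is a fin_num by rewrite fin_numE fNy lt_eqF.
have gw_fin : fenchel g w \is a fin_num by rewrite fin_numE gsNy lt_eqF.
have xsub k : (0 < k)%N -> subdiff f (x k) (sf_ h alpha x u k).
  exact: DYS_subdiff xu_DYS.
have usub k : (0 < k)%N -> subdiff (fenchel g) (u k) (p_ alpha x u k).
  exact: DYS_subdiff_conj xu_DYS.
have [fxb_fin If_le0] :=
  average_subdiff_le0 _ K_gt0 _ _ _ y f_convex fNy fy_fin xsub.
have [gub_fin Ig_le0] := average_subdiff_le0 _ K_gt0 _ _ _ w
  (fenchel_econvex _ g_proper) gsNy gw_fin usub.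
have Ih_le0 := I_h_le0 h alpha x u K L y L_gt0 alphaE h_convex h_smooth.
have Sh_ge0 := S_h_ge0 h alpha x u K y alpha_gt0.
have S1_ge0 := S_1_ge0 h alpha x u K y w alpha_gt0.
have S2_ge0 := S_2_ge0 h alpha x u K alpha_gt0.
set If := fine _ - _ + _ in If_le0; set Ig := fine _ - _ + _ in Ig_le0.
set Ih := I_h _ _ _ _ _ _ in Ih_le0; set Sh := S_h _ _ _ _ _ _ in Sh_ge0.
set S1 := S_1 _ _ _ _ _ _ _ in S1_ge0; set S2 := S_2 _ _ _ _ _ in S2_ge0.
have gapE : gap = (bound + If + Ig + Ih - (Sh + S1 + S2))%:E.
  rewrite /gap /lagrangian -(fineK fxb_fin) -(fineK gw_fin) -(fineK fy_fin).
  rewrite -(fineK gub_fin) -!EFinD; congr (_%:E).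
  have := energy_identity h alpha x u K y w (lt0r_neq0 alpha_gt0) K_gt0.
  rewrite /= /bound div1r -/Sh -/S1 -/S2 !big_split /=.
  rewrite /Ih I_hE // /If /Ig !big_split /= => energy.
  by lra.
split; first by rewrite gapE lee_fin; lra.
move=> sfb pb q _ ubpb wq; rewrite gapE -/Ih -/Sh -/S1 -/S2.
have -> : I_f f h alpha x u K y sfb = If%:E.
  by apply: I_fE => // k k0; case: (xsub k k0).
have -> : I_g g alpha x u K w pb q = Ig%:E by exact: I_gE.
split=> [[gap_eq]|[[If0] [[Ig0] [-> [-> [-> ->]]]]]]; last first.
  by rewrite If0 Ig0 !addr0 subr0.
by do !split; try congr (_%:E); lra.
Qed.
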